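(* Let $\mathcal{S}=\mathcal{S}^{P+}$ or $\mathcal{S}=\mathcal{S}^{P+}_\mu$. Let $\mu$ be a monotone measure on $(X,\mathcal{B})$ which is continuous at $\emptyset$, and let $\{f_n\}_{n\in\mathbb{N}}$ be a decreasing sequence of measurable functions on $X$. Assume that $\int^{\uparrow}_{\mathcal{S}} 1_X\,d\mu<\infty$, that $\int^{\uparrow}_{\mathcal{S}} f_1\,d\mu<\infty$, and that $f_n\searrow 0$ pointwise as $n\to\infty$. Then $$\lim_{n\to\infty}\int^{\uparrow}_{\mathcal{S}} f_n\,d\mu=0 .$$
   Context: $(X,\mathcal{B})$ is a measurable space ($\mathcal{B}$ a $\sigma$-algebra on $X$). Measurable functions are real-valued. $1_A$ is the indicator function of $A$. A monotone measure is a set function $\mu:\mathcal{B}\to[0,\infty)$ with $\mu(\emptyset)=0$ and $\mu(A)\le\mu(B)$ whenever $A\subset B$; throughout, every monotone measure is assumed to be continuous from above and below, i.e. $A_n\nearrow A$ or $A_n\searrow A$ implies $\mu(A_n)\to\mu(A)$. Continuity at $\emptyset$ means $A_n\searrow\emptyset$ implies $\mu(A_n)\to 0$. No additivity is assumed. A simple function is a finite or infinite sequence of pairs $\varphi=\{(a_k,A_k)\}_k$ with $a_k\in\mathbb{R}$, $A_k\in\mathcal{B}$; it is identified with the function $\varphi(x)=\sum_k a_k 1_{A_k}(x)$, but its basic sum $\mu(\varphi)=\sum_k a_k\mu(A_k)$ depends on the sequence of pairs. A partition of $X$ is a family of pairwise disjoint sets in $\mathcal{B}$ (possibly empty) with union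 $X$. The classes are: - $\mathcal{S}^{P+}$: all finite sequences $\{(a_k,A_k)\}_{k=1}^n$, $n\in\mathbb{N}$, with $a_k\ge 0$ and $\{A_k\}_k$ a partition of $X$; - $\mathcal{S}^{P+}_\mu$: all infinite sequences $\{(a_k,A_k)\}_{k=1}^\infty$ with $a_k\ge 0$, $\sum_k a_k\mu(A_k)<\infty$ and $\{A_k\}_k$ a partition of $X$. For a class $\mathcal{S}$ and a measurable function $f$, $L(\mathcal{S},f)=\{\varphi\in\mathcal{S}:\varphi(x)\le f(x)\ \forall x\in X\}$ and $\int^{\uparrow}_{\mathcal{S}} f\,d\mu=\sup\{\mu(\varphi):\varphi\in L(\mathcal{S},f)\}$, taken in the extended reals. *)

(* Defs.v *)
From HB Require Import structures.
From mathcomp Require Import all_boot all_order all_algebra.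
From mathcomp Require Import all_classical all_reals all_analysis.
Import Order.TTheory GRing.Theory Num.Theory.
Import numFieldNormedType.Exports.

Set Implicit Arguments.
Unset Strict Implicit.
Unset Printing Implicit Defensive.

Local Open Scope classical_set_scope.
Local Open Scope ring_scope.
Local Open Scope ereal_scope.

(* Only the values of mu on measurable sets matter.  Continuity from below and
   from above is part of the notion of monotone measure used here. *)
Record monotone_measure d (T : measurableType d) (R : realType)
    (mu : set T -> R) : Prop := MonotoneMeasure {
  mm_set0 : mu set0 = 0%R ;
  mm_ge0 : forall A, measurable A -> (0 <= mu A)%R ;
  mm_le : forall A B, measurable A -> measurable B ->
    A `<=` B -> (mu A <= mu B)%R ;
  mm_below : forall A : nat -> set T, (forall n, measurable (A n)) ->
    nondecreasing_seq A -> mu (A n) @[n --> \oo] --> mu (\bigcup_n A n) ;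
  mm_above : forall A : nat -> set T, (forall n, measurable (A n)) ->
    nonincreasing_seq A -> mu (A n) @[n --> \oo] --> mu (\bigcap_n A n) }.

Definition continuous_at_set0 d (T : measurableType d) (R : realType)
    (mu : set T -> R) : Prop :=
  forall A : nat -> set T, (forall n, measurable (A n)) ->
    nonincreasing_seq A -> \bigcap_n A n = set0 ->
    mu (A n) @[n --> \oo] --> (0 : R)%R.

(* A finite or infinite sequence of pairs (a_k, A_k), kept as a sequence since
   its basic sum is not determined by the function it represents; infinite
   sequences are indexed from 0.  Measurability of the A_k is imposed by
   [measurable_partition]. *)
Inductive simple_function (T : Type) (R : realType) : Type :=
| FinSimple (n : nat) (a : 'I_n -> R) (A : 'I_n -> set T)
| InfSimple (a : nat -> R) (A : nat -> set T).

Definition simple_value (T : Type) (R : realType)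
    (phi : simple_function T R) (x : T) : \bar R :=
  match phi with
  | @FinSimple _ _ n a A => \sum_(k < n) (a k * \1_(A k) x)%:E
  | InfSimple a A => \sum_(0 <= k <oo) (a k * \1_(A k) x)%:E
  end.

Definition basic_sum (T : Type) (R : realType) (mu : set T -> R)
    (phi : simple_function T R) : \bar R :=
  match phi with
  | @FinSimple _ _ n a A => \sum_(k < n) (a k * mu (A k))%:E
  | InfSimple a A => \sum_(0 <= k <oo) (a k * mu (A k))%:E
  end.

(* Unlike [classical_sets.partition], empty blocks are allowed. *)
Definition measurable_partition d (T : measurableType d) (I : Type)
    (A : I -> set T) : Prop :=
  [/\ forall k, measurable (A k), trivIset setT A & \bigcup_k A k = setT].

Definition SPplus d (T : measurableType d) (R : realType) :
    set (simple_function T R) :=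
  [set phi | match phi with
             | @FinSimple _ _ n a A =>
                 (forall k, (0 <= a k)%R) /\ measurable_partition A
             | InfSimple _ _ => False
             end].

Definition SPplus_mu d (T : measurableType d) (R : realType)
    (mu : set T -> R) : set (simple_function T R) :=
  [set phi | match phi with
             | @FinSimple _ _ _ _ _ => False
             | InfSimple a A =>
                 [/\ forall k, (0 <= a k)%R,
                     \sum_(0 <= k <oo) (a k * mu (A k))%:E < +oo
                   & measurable_partition A]
             end].

Definition simple_below (T : Type) (R : realType)
    (S : set (simple_function T R)) (f : T -> R) : set (simple_function T R) :=
  [set phi | S phi /\ forall x, simple_value phi x <= (f x)%:E].

Definition lower_integral (T : Type) (R : realType)
    (S : set (simple_function T R)) (mu : set T -> R) (f : T -> R) : \bar R :=
  ereal_sup [set basic_sum mu phi | phi in simple_below S f].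

(* Main.v *)
(** For both classes the integral of [f >= 0] is the supremum of the sums
    [\sum_k a_k mu(A_k)] over finite disjoint families of measurable sets with
    [a_k <= f] on [A_k].  Such sums add up over disjoint regions.  If the sums
    supported in [B_n], for [B_n] decreasing to the empty set, exceeded [e > 0]
    for all [n], then continuity from below would let one cut them down to
    [B_n \ B_m] for some [m]; iterating, disjoint shells
    [B_n \ B_m], [B_m \ B_p], ... would make the integral infinite.  The theorem
    follows by splitting a family below [f_n] into the terms with [a_k <= e],
    which contribute at most [e] times the integral of 1, and the terms with
    [a_k > e], which live on the set where [f_n > e]. *)
Require Import Defs.
From HB Require Import structures.
From mathcomp Require Import all_boot all_order all_algebra.
From mathcomp Require Import all_classical all_reals all_analysis.
Import Order.TTheory GRing.Theory Num.Theory.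
Import numFieldNormedType.Exports.

Local Open Scope classical_set_scope.
Local Open Scope ring_scope.
Local Open Scope ereal_scope.

(** * Disjoint families below a function, compared with the two integrals *)

(** The blocks need not cover the space, so a family can be cut down to a region or joined to
    another one. An empty block puts no upper bound on its coefficient. *)
Definition lower_packing {d : measure_display} {X : measurableType d}
    {R : realType} (f : X -> R) (B : set X) (a : nat -> R) (A : nat -> set X) :
    Prop :=
  [/\ forall k, (0 <= a k)%R, forall k, measurable (A k), trivIset setT A &
      forall k x, A k x -> B x /\ (a k <= f x)%R].

Definition packing_sum {d : measure_display} {X : measurableType d}
    {R : realType} (mu : set X -> R) (f : X -> R) (B : set X) : set R :=
  [set r | exists n a A, lower_packing f B a A /\
     r = (\sum_(k < n) a k * mu (A k))%R].

Lemma lower_packing_value (d : measure_display) (X : measurableType d)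
    (R : realType) (f : X -> R) (B : set X) (a : nat -> R) (A : nat -> set X)
    (m : nat) (x : X) :
  lower_packing f B a A -> (0 <= f x)%R ->
  (\sum_(k < m) a k * \1_(A k) x <= f x)%R.
Proof.
move=> [a0 mA tA Af] f0.
(* By disjointness at most one term is nonzero at [x]; recording its index lets the induction
   exclude a second one. *)
suff [->//|[k [_ Akx ->]]] : (\sum_(k < m) a k * \1_(A k) x)%R = 0%R \/
    exists k, [/\ (k < m)%N, A k x &
      (\sum_(k < m) a k * \1_(A k) x)%R = a k].
  by have [] := Af _ _ Akx.
elim: m => [|m IH]; first by left; rewrite big_ord0.
rewrite big_ord_recr /= indicE.
have [Amx|Amx] := pselect (A m x); last first.
  rewrite memNset// mulr0 addr0.
  case: IH => [->|[k [km Akx ->]]]; first by left.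
  by right; exists k; split => //; exact: ltnW.
right; exists m; split => //; rewrite mem_set// mulr1.
case: IH => [->|[k [km Akx _]]]; first by rewrite add0r.
have := tA k m I I (ex_intro _ x (conj Akx Amx)).
by move=> kmE; rewrite kmE ltnn in km.
Qed.

Lemma le_simple_value (X : Type) (R : realType) (a : nat -> R)
    (A : nat -> set X) (k : nat) (x : X) :
  (forall i, 0 <= a i)%R -> A k x ->
  (a k)%:E <= \sum_(0 <= i <oo) (a i * \1_(A i) x)%:E.
Proof.
move=> a0 Akx; have u0 i : 0 <= (a i * \1_(A i) x)%:E.
  by rewrite lee_fin mulr_ge0.
apply: le_trans (nneseries_lim_ge k.+1 _); last by move=> *; exact: u0.
rewrite big_nat_recr//= indicE mem_set// mulr1 leeDr//.
by apply: sume_ge0 => i _; exact: u0.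
Qed.

(** The complement [C] of the first [n] blocks, with coefficient 0, completes the family to a
    partition; as [f >= 0], it stays below [f]. Continued by empty sets, the same family serves both
    classes. *)
Lemma packing_sum_le_lower_integral (d : measure_display)
    (X : measurableType d) (R : realType) (mu : set X -> R)
    (S : set (simple_function X R)) (f : X -> R) (r : R) :
  S = @SPplus d X R \/ S = @SPplus_mu d X R mu -> (forall x, 0 <= f x)%R ->
  packing_sum mu f setT r -> r%:E <= lower_integral S mu f.
Proof.
move=> hS f0 [n [a [A [[a0 mA tA Af] ->]]]].
pose C := ~` \bigcup_(i in `I_n) A i.
pose a' k := if (k < n)%N then a k else 0%R.
pose A' k := if (k < n)%N then A k else if k == n then C else set0.
have pk : lower_packing f setT a' A'.
  split.
  - by move=> k; rewrite /a'; case: ifP.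
  - move=> k; rewrite /A'; case: ifP => // _; case: ifP => // _.
    by apply: measurableC; exact: bigcup_measurable.
  - have CA i x : (i < n)%N -> A i x -> C x -> False.
      by move=> ilt Aix; apply; exists i.
    move=> i j _ _ [x []]; rewrite /A'.
    case: ltnP => [ilt|_]; case: ltnP => [jlt|_].
    + by move=> Aix Ajx; apply: tA => //; exists x.
    + by case: ifP => // _ Aix /(CA _ _ ilt Aix).
    + by case: ifP => // _ Cx /(CA _ _ jlt)/(_ Cx).
    + by case: eqP => // ->; case: eqP => // ->.
  - move=> k x; rewrite /A' /a'; case: ltnP => [_ /Af[]//|_ _]; split => //.
have [a'0 mA' tA' _] := pk.
have cov x : exists2 k, (k < n.+1)%N & A' k x.
  have [[i /= ilt Aix]|Cx] := pselect ((\bigcup_(i in `I_n) A i) x).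
    by exists i; [exact: ltnW|rewrite /A' ilt].
  by exists n => //; rewrite /A' ltnn eqxx.
have sumE : (\sum_(k < n) a k * mu (A k) = \sum_(k < n.+1) a' k * mu (A' k))%R.
  rewrite big_ord_recr/= {2}/a' ltnn mul0r addr0.
  by apply: eq_bigr => i _; rewrite /a' /A' ltn_ord.
have infE (g : nat -> R) : \sum_(0 <= k <oo) (a' k * g k)%:E =
    (\sum_(k < n.+1) a' k * g k)%:E.
  rewrite -sumEFin -(big_mkord xpredT (fun k => (a' k * g k)%:E)).
  (* All coefficients from index [n] on vanish, so the partial sums are eventually constant. *)
  apply: lim_near_cst => //; exists n.+1 => // m /= nm.
  rewrite (big_cat_nat (leq0n _) nm)//= [X in _ + X](_ : _ = 0) ?adde0//.
  rewrite big_nat_cond; apply: big1 => k /andP[/andP[nk _] _].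
  by rewrite /a' ltnNge (ltnW nk)/= mul0r.
case: hS => ->; apply: ereal_sup_ubound.
- exists (FinSimple (fun k : 'I_n.+1 => a' k) (fun k : 'I_n.+1 => A' k)).
    split => [|x] /=.
      split => //; split => //.
      + by move=> i j _ _ ij; apply: val_inj; apply: tA'.
      + rewrite -subTset => x _; have [k kn Akx] := cov x.
        by exists (Ordinal kn).
    by rewrite sumEFin lee_fin; exact: lower_packing_value pk _.
  by rewrite /= sumEFin sumE.
- exists (InfSimple a' A').
    split => [|x] /=.
      split => //; first by rewrite infE ltry.
      split => //.
      by rewrite -subTset => x _; have [k _ Akx] := cov x; exists k.
    by rewrite infE lee_fin; exact: lower_packing_value pk _.
  by rewrite /= infE sumE.
Qed.

(** A finite simple function is itself a disjoint family below [f]. For an infinite one, every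
    partial basic sum is a packing sum, and the bound passes to the limit. *)
Lemma lower_integral_le (d : measure_display)
    (X : measurableType d) (R : realType) (mu : set X -> R)
    (S : set (simple_function X R)) (f : X -> R) (c : \bar R) :
  S = @SPplus d X R \/ S = @SPplus_mu d X R mu ->
  (forall A, measurable A -> 0 <= mu A)%R ->
  (forall r, packing_sum mu f setT r -> r%:E <= c) ->
  lower_integral S mu f <= c.
Proof.
move=> hS mu0 hc; apply: ge_ereal_sup => _ [phi [Sphi phif] <-].
case: hS Sphi phif => ->; case: phi => //=.
- move=> n a A [a0 [mA tA _]] phif; rewrite sumEFin; apply: hc.
  (* [insub] extends the family from ['I_n] to [nat], with coefficient 0 and empty blocks from [n]
     on. *)
  pose a' k := if insub k is Some i then a i else 0%R.
  pose A' k := if insub k is Some i then A i else set0.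
  exists n, a', A'; split; last first.
    by apply: eq_bigr => i _; rewrite /a' /A' valK.
  rewrite /a' /A'; split.
  + by move=> k; case: insubP.
  + by move=> k; case: insubP.
  + move=> i j _ _; case: insubP => [u _ <-|_]; last by rewrite set0I => -[].
    case: insubP => [v _ <- /(tA _ _ I I) ->//|_].
    by rewrite setI0 => -[].
  + move=> k x; case: insubP => // u _ uk Aux; split => //.
    rewrite -lee_fin; apply: le_trans (phif x).
    rewrite sumEFin lee_fin (bigD1 u)//= indicE mem_set// mulr1 lerDl.
    by apply: sumr_ge0 => i _; rewrite mulr_ge0.
- move=> a A [a0 _ [mA tA _]] phif.
  apply: lime_le.
    by apply: is_cvg_nneseries => k _ _; rewrite lee_fin mulr_ge0// mu0.
  apply: nearW => n; rewrite sumEFin big_mkord; apply: hc.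
  exists n, a, A; split => //; split => // k x Akx; split => //.
  rewrite -lee_fin; apply: le_trans (phif x).
  exact: le_simple_value.
Qed.

(** * Monotonicity and additivity of packing sums *)

Lemma sub_packing_sum (d : measure_display) (X : measurableType d)
    (R : realType) (mu : set X -> R) (f g : X -> R) (B C : set X) :
  (forall x, f x <= g x)%R -> B `<=` C ->
  packing_sum mu f B `<=` packing_sum mu g C.
Proof.
move=> fg BC r [n [a [A [[a0 mA tA Af] ->]]]].
exists n, a, A; split => //; split => // k x /Af[Bx af].
by split; [exact: BC|exact: le_trans (fg x)].
Qed.

Lemma packing_sum0 (d : measure_display) (X : measurableType d)
    (R : realType) (mu : set X -> R) (f : X -> R) (B : set X) :
  packing_sum mu f B 0%R.
Proof.
exists 0%N, (fun=> 0%R), (fun=> set0); split; last by rewrite big_ord0.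
by split => // i j _ _; rewrite set0I => -[].
Qed.

(** The two families are concatenated; blocks of different families lie in the disjoint regions [B]
    and [C]. *)
Lemma packing_sumD (d : measure_display) (X : measurableType d)
    (R : realType) (mu : set X -> R) (f : X -> R) (B C D : set X) (r s : R) :
  B `&` C = set0 -> B `|` C `<=` D ->
  packing_sum mu f B r -> packing_sum mu f C s ->
  packing_sum mu f D (r + s)%R.
Proof.
move=> BC0 BCD [n [a [A [[a0 mA tA Af] ->]]]] [m [b [E [[b0 mE tE Ef] ->]]]].
have disj i j x : A i x -> E j x -> False.
  move=> /Af[Bx _] /Ef[Cx _].
  by have : (B `&` C) x by []; rewrite BC0.
exists (n + m)%N, (fun k => if (k < n)%N then a k else b (k - n)%N),
  (fun k => if (k < n)%N then A k else E (k - n)%N); split.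
  split.
  - by move=> k; case: ifP.
  - by move=> k; case: ifP.
  - move=> i j _ _ [x []].
    case: ltnP => [_|ni]; case: ltnP => [_|nj].
    + by move=> Aix Ajx; apply: tA => //; exists x.
    + by move=> /disj /[apply].
    + by move=> /[swap] /disj /[apply].
    + move=> Eix Ejx; have := tE _ _ I I (ex_intro _ x (conj Eix Ejx)).
      by move/(congr1 (addn n)); rewrite !subnKC.
  - move=> k x; case: ifP => _ => [/Af[Bx]|/Ef[Cx]] ?; split => //; apply: BCD.
      by left.
    by right.
rewrite big_split_ord/=; congr (_ + _)%R; apply: eq_bigr => i _.
  by rewrite ltn_ord.
by rewrite ltnNge leq_addr/= addKn.
Qed.

(** * Packing sums over regions decreasing to the empty set *)

Lemma packing_sum_shell (d : measure_display) (X : measurableType d)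
    (R : realType) (mu : set X -> R) (f : X -> R) (B : nat -> set X)
    (e : R) (N : nat) (r : R) :
  monotone_measure mu -> (forall n, measurable (B n)) -> nonincreasing_seq B ->
  \bigcap_n B n = set0 -> packing_sum mu f (B N) r -> (e < r)%R ->
  exists M s, [/\ (N <= M)%N, packing_sum mu f (B N `\` B M) s & (e < s)%R].
Proof.
move=> hmu mB decB capB [n [a [A [[a0 mA tA Af] rE]]]] er.
have cvA k : mu (A k `\` B m) @[m --> \oo] --> mu (A k).
  (* The [B m] have empty intersection, so the sets removed from [A k] shrink to nothing. *)
  have AE : \bigcup_m (A k `\` B m) = A k.
    by rewrite -[RHS]setD0 -capB setDE setC_bigcap setI_bigcupr.
  rewrite -[X in _ --> mu X]AE; apply: mm_below => //.
  - by move=> m; exact: measurableD.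
  - move=> p q pq; rewrite subsetEset; apply: setDS.
    by rewrite -subsetEset; exact: decB.
have : (\sum_(k < n) a k * mu (A k `\` B m))%R @[m --> \oo] --> r.
  rewrite {}rE; elim: n => [|n IH].
    by under eq_fun do rewrite big_ord0; rewrite big_ord0; exact: cvg_cst.
  under eq_fun do rewrite big_ord_recr/=.
  by rewrite big_ord_recr/=; apply: cvgD => //; apply: cvgMr.
move=> /cvgr_gt/(_ _ er)[M _ HM].
exists (maxn N M), (\sum_(k < n) a k * mu (A k `\` B (maxn N M)))%R; split.
- exact: leq_maxl.
- exists n, a, (fun k => A k `\` B (maxn N M)); split => //; split => //.
  + by move=> k; exact: measurableD.
  + by move=> i j _ _ [x [[Aix _] [Ajx _]]]; apply: tA => //; exists x.
  + by move=> k x [/Af[Bx ax] nBx].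
- by apply: HM; exact: leq_maxr.
Qed.

Lemma packing_sum_cvg0 (d : measure_display) (X : measurableType d)
    (R : realType) (mu : set X -> R) (f : X -> R) (B : nat -> set X)
    (c e : R) :
  monotone_measure mu -> (forall n, measurable (B n)) -> nonincreasing_seq B ->
  \bigcap_n B n = set0 ->
  (forall r, packing_sum mu f setT r -> r <= c)%R -> (0 < e)%R ->
  exists N, forall n r, (N <= n)%N -> packing_sum mu f (B n) r -> (r <= e)%R.
Proof.
move=> hmu mB decB capB fc e0; apply: contrapT => /forallNP big.
have step N : exists M s,
    [/\ (N <= M)%N, packing_sum mu f (B N `\` B M) s & (e < s)%R].
  have [n [r [Nn Br er]]] : exists n r,
      [/\ (N <= n)%N, packing_sum mu f (B n) r & (e < r)%R].
    apply: contrapT => H; apply: (big N) => n r Nn Br.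
    rewrite leNgt; apply/negP => er.
    by apply: H; exists n, r.
  apply: packing_sum_shell er => //.
  by apply: sub_packing_sum Br => //; rewrite -subsetEset; exact: decB.
(* Stacks [j] disjoint shells beyond any [N], each contributing more than [e]. *)
have iterate j : forall N, exists M s, [/\ (N <= M)%N,
    packing_sum mu f (B N `\` B M) s & (e *+ j <= s)%R].
  elim: j => [|j IH] N.
    by exists N, 0%R; split => //; exact: packing_sum0.
  have [M [s [NM Bs es]]] := step N.
  have [P [t [MP Bt et]]] := IH M.
  exists P, (s + t)%R; split.
  - exact: leq_trans MP.
  - apply: packing_sumD Bs Bt.
      by rewrite -subset0 => x [[_ nBx] [Bx _]].
    have subB p q : (p <= q)%N -> B q `<=` B p.
      by rewrite -subsetEset; exact: decB.
    move=> x [[BNx nBMx]|[BMx nBPx]]; split => //.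
      by move=> /(subB _ _ MP).
    exact: (subB _ _ NM).
  - by rewrite mulrS lerD// ltW.
(* More than [c / e] shells give a sum exceeding the bound [c]. *)
have [M [s [_ Bs es]]] := iterate (Num.bound (c / e)) 0%N.
have sc : (s <= c)%R by apply: fc; apply: sub_packing_sum Bs.
have c0 : (0 <= c / e)%R.
  by rewrite divr_ge0 ?(ltW e0)//; apply: fc; exact: packing_sum0.
have := archi_boundP c0; rewrite ltr_pdivrMr// mulr_natl ltNge.
by rewrite (le_trans es sc).
Qed.

Lemma packing_sum_le_split (d : measure_display) (X : measurableType d)
    (R : realType) (mu : set X -> R) (f : X -> R) (c b e r : R) :
  mu set0 = 0%R -> (forall A, measurable A -> 0 <= mu A)%R -> (0 <= e)%R ->
  (forall s, packing_sum mu (\1_[set: X]) setT s -> s <= c)%R ->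
  (forall s, packing_sum mu f [set x | e < f x]%R s -> s <= b)%R ->
  packing_sum mu f setT r -> (r <= e * c + b)%R.
Proof.
move=> mu0 mu_ge0 e0 hc hb [n [a [A [[a0 mA tA Af] ->]]]].
(* Unwanted blocks are emptied rather than reindexed: [mu set0 = 0] removes their terms, and the
   constraints on them become void. *)
pose low k := if (a k <= e)%R then A k else set0.
pose high k := if (a k <= e)%R then set0 else A k.
have sub_trivIset (E : nat -> set X) : (forall k, E k `<=` A k) ->
    trivIset setT E.
  move=> EA i j _ _ [x [Eix Ejx]]; apply: tA => //.
  by exists x; split; exact: EA.
apply: (@le_trans _ _ (e * (\sum_(k < n) 1 * mu (low k)) +
    \sum_(k < n) a k * mu (high k))%R).
  rewrite mulr_sumr -big_split/=; apply: ler_sum => k _.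
  rewrite /low /high mul1r; case: ifP => [ake|_].
    by rewrite mu0 mulr0 addr0 ler_wpM2r// mu_ge0.
  by rewrite mu0 mulr0 add0r.
apply: lerD.
  apply: ler_wpM2l => //; apply: hc; exists n, (fun=> 1%R), low.
  split => //; split => //.
  - by move=> k; rewrite /low; case: ifP.
  - by apply: sub_trivIset => k x; rewrite /low; case: ifP.
  - by move=> k x _; split => //; rewrite indicT.
apply: hb; exists n, a, high; split => //; split => //.
- by move=> k; rewrite /high; case: ifP.
- by apply: sub_trivIset => k x; rewrite /high; case: ifP.
- move=> k x; rewrite /high; case: leP => // eak /Af[_ akf].
  by split => //=; exact: lt_le_trans akf.
Qed.

(** * Convergence of the integrals to zero *)

Theorem theorem18 (d : measure_display) (X : measurableType d) (R : realType)
    (mu : set X -> R) (S : set (simple_function X R)) (f : nat -> X -> R)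
    (hS : S = @SPplus d X R \/ S = @SPplus_mu d X R mu)
    (hmu : monotone_measure mu)
    (hmu0 : continuous_at_set0 mu)
    (hf : forall n, measurable_fun [set: X] (f n))
    (hdecr : forall x, nonincreasing_seq (fun n => f n x))
    (h1 : lower_integral S mu (\1_[set: X]) < +oo)
    (hf1 : lower_integral S mu (f 0%N) < +oo)
    (hlim : forall x, f n x @[n --> \oo] --> (0 : R)%R) :
  lower_integral S mu (f n) @[n --> \oo] --> (0 : \bar R).
Proof.
(* A decreasing sequence stays above its limit. *)
have f0 n x : (0 <= f n x)%R.
  rewrite -(cvg_lim _ (hlim x))//; apply: nonincreasing_cvgn_ge => //.
  by apply/cvg_ex; exists 0%R.
have int_ge0 g : (forall x, 0 <= g x)%R -> 0 <= lower_integral S mu g.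
  move=> g0; apply: packing_sum_le_lower_integral => //.
  exact: packing_sum0.
have bounded (g : X -> R) : (forall x, 0 <= g x)%R ->
    lower_integral S mu g < +oo ->
    exists c : R, forall r, packing_sum mu g setT r -> (r <= c)%R.
  move=> g0 goo; exists (fine (lower_integral S mu g)) => r gr.
  rewrite -lee_fin fineK; first exact: packing_sum_le_lower_integral.
  by rewrite ge0_fin_numE// int_ge0.
have [c0 hc0] := bounded _ (f0 0%N) hf1.
have [c hc] : exists c : R, forall r,
    packing_sum mu (\1_[set: X]) setT r -> (r <= c)%R.
  by apply: bounded.
have c_ge0 : (0 <= c)%R by apply: hc; exact: packing_sum0.
(* The integrals are nonnegative, so eventual upper bounds suffice; the bound for [e = 1] makes them
   eventually finite. *)
suff eps (e : R) : (0 < e)%R ->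
    \forall n \near \oo, lower_integral S mu (f n) <= e%:E.
  apply/fine_cvgP; split.
    have := eps 1%R ltr01; apply: filterS => n le1.
    by rewrite ge0_fin_numE ?int_ge0// (le_lt_trans le1)// ltry.
  apply/cvgrPdist_le => e e0; have := eps e e0; apply: filterS => n le_e.
  have int_fin : lower_integral S mu (f n) \is a fin_num.
    by rewrite ge0_fin_numE ?int_ge0// (le_lt_trans le_e)// ltry.
  rewrite sub0r normrN ger0_norm; first by rewrite -lee_fin fineK.
  by rewrite fine_ge0 // int_ge0.
move=> e0.
(* Chosen so that [t * c <= e / 2]; the [+ 1] keeps the divisor positive when [c = 0]. *)
pose t := (e / 2 / (c + 1))%R.
have c1 : (0 < c + 1)%R by rewrite ltr_wpDl.
have t0 : (0 < t)%R by rewrite !divr_gt0.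
pose B n := [set x | t < f n x]%R.
have mB n : measurable (B n).
  have -> : B n = [set: X] `&` f n @^-1` `]t, +oo[.
    by rewrite setTI; apply/seteqP; split => x /=; rewrite in_itv/= andbT.
  exact: hf.
have decB : nonincreasing_seq B.
  move=> p q pq; rewrite subsetEset => x /= tq.
  exact: lt_le_trans tq (hdecr x _ _ pq).
have capB : \bigcap_n B n = set0.
  rewrite -subset0 => x /= Bx.
  have [N _ /(_ N (leqnn N))] := cvgr_lt _ (hlim x) _ t0.
  by rewrite /= ltNge (ltW (Bx N I)).
have e20 : (0 < e / 2)%R by rewrite divr_gt0.
(* Applied to the fixed function [f 0], which dominates every [f n], so that one [N] controls all
   later sums over [B n]. *)
have [N HN] := @packing_sum_cvg0 _ _ _ _ _ _ c0 _ hmu mB decB capB hc0 e20.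
exists N => // n /= Nn.
apply: lower_integral_le => // [|r fr]; first exact: mm_ge0.
rewrite lee_fin; apply: (@le_trans _ _ (t * c + e / 2)%R).
  apply: packing_sum_le_split fr => //.
  - exact: mm_set0.
  - exact: mm_ge0.
  - exact: ltW.
  - move=> s fs; apply: (HN n) => //; apply: sub_packing_sum fs => // x.
    exact: hdecr.
rewrite [leRHS](splitr e) lerD2r /t mulrAC ler_pdivrMr//.
by rewrite ler_wpM2l ?(ltW e20)// lerDl.
Qed.
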